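(* Let $g\in\mathbb{F}_q[T]$ be monic and $c\in\mathbb{F}_q[T]$. Then, for all $u\in\mathbb{C}$ (as an identity of meromorphic functions of $u$), $$\mathcal{Z}(u;c,g)=u^{\deg(g)-1}\sum_{\lambda\in\mathbb{F}_q^\times}\Big[\frac{e_q(-\lambda)}{q}-\frac{1}{q(1-qu)}\Big]\mathcal{D}_1\Big(\frac{1}{qu};\frac{\lambda c}{g}\Big).$$
   Context: $q=p^\eta$ is a prime power; $e_q(y)=\exp(2\pi i\,\mathrm{Tr}_{\mathbb{F}_q/\mathbb{F}_p}(y)/p)$ for $y\in\mathbb{F}_q$; for $\alpha=\sum_{j\le N}\alpha_jT^j\in\mathbb{F}_q((1/T))$, $e(\alpha)=e_q(\alpha_{-1})$. Let $\mathcal{M}$ be the set of monic polynomials in $\mathbb{F}_q[T]$. For $|u|<1/q$ define $$\mathcal{Z}(u;c,g)=\sum_{\substack{f\in\mathcal{M}\\ f\equiv c\ (\mathrm{mod}\ g)}}u^{\deg f},\qquad \mathcal{D}_1(u;c/g)=\sum_{f\in\mathcal{M}}e(cf/g)\,u^{\deg f};$$ both are extended by meromorphic continuation to all $u\in\mathbb{C}$ (they are rational functions of $u$). *)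

(* Defs.v *)
From HB Require Import structures.
From mathcomp Require Import all_boot all_order all_algebra all_fingroup all_field.
From mathcomp Require Import finmap complex zify.
From mathcomp Require Import all_classical all_reals all_analysis.
From mathcomp.analysis.showcase Require Import summability.

Set Implicit Arguments.
Unset Strict Implicit.
Unset Printing Implicit Defensive.

Import Order.TTheory GRing.Theory Num.Theory.
Import numFieldNormedType.Exports.

Local Open Scope ring_scope.
Local Open Scope complex_scope.

Definition deg (F : nzRingType) (f : {poly F}) : nat := (size f).-1.

Section FiniteFieldCharacter.
Variables (R : realType) (p : nat) (F : finFieldType).
Hypothesis charFp : p \in [pchar F].

(* [pPrimeCharType charFp] is F seen as a Galois extension of 'F_p. The value
   of [galTrace] is an element of F in the prime subfield; we take the element
   of 'F_p that it comes from (see [FqTrP]; the default is never used). *)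
Definition FqTr (y : F) : 'F_p :=
  odflt 0 [pick k : 'F_p |
    k%:A == galTrace 1%AS {:pPrimeCharType charFp} (y : pPrimeCharType charFp)].

Lemma FqTrP (y : F) : (FqTr y)%:A =
  galTrace 1%AS {:pPrimeCharType charFp} (y : pPrimeCharType charFp).
Proof.
rewrite /FqTr; case: pickP => [k /eqP //|noK].
have : galTrace 1%AS {:pPrimeCharType charFp} (y : pPrimeCharType charFp)
         \in (1%AS : {subfield _}).
  by apply: mem_galTrace (memvf _); apply: finField_galois; apply: subvf.
by case/vlineP => k Ek; move: (noK k); rewrite Ek eqxx.
Qed.

Definition e_q (y : F) : R[i] :=
  let t : R := 2 * pi * (FqTr y : nat)%:R / p%:R in cos t +i* sin t.

End FiniteFieldCharacter.

(* An element \sum_(j <= N) a_j T^j of F((1/T)), given by its coefficients. *)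
Record laurent (F : nzRingType) := Laurent {
  lcoef :> int -> F;
  _ : exists N : int, forall j, N < j -> lcoef j = 0
}.

Section QuotientExpansion.
Variable F : fieldType.
Implicit Types h g : {poly F}.

(* The coefficient of T^(-m) in h/g is the constant coefficient of the
   polynomial part of T^m h/g. *)
Definition lquot_coef h g (j : int) : F :=
  match j with
  | Posz n => (h %/ g)`_n
  | Negz n => (('X^(n.+1) * h) %/ g)`_0
  end.

Fact lquot_bounded h g :
  exists N : int, forall j, N < j -> lquot_coef h g j = 0.
Proof.
exists (size (h %/ g))%:Z => -[n|n] //=.
by rewrite ltz_nat => /ltnW; exact: nth_default.
Qed.

Definition lquot h g : laurent F := Laurent (lquot_bounded h g).

Lemma divp_shift h g n m i : g != 0 ->
  (('X^(n + m) * h) %/ g)`_(i + m) = (('X^n * h) %/ g)`_i.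
Proof.
move=> g0; set P := 'X^n * h.
have -> : 'X^(n + m) * h = ('X^m * (P %/ g)) * g + 'X^m * (P %% g).
  by rewrite -mulrA -mulrDr -divp_eq /P mulrA exprD [X in X * h]mulrC.
rewrite divp_addl_mul // coefD coefXnM ltnNge leq_addl /= addnK.
rewrite [X in _ + X]nth_default ?addr0 //; apply: leq_trans (leq_addl i m).
have [->|r0] := eqVneq (P %% g) 0; first by rewrite mulr0 div0p size_poly0.
rewrite size_divp // size_monicM ?monicXn // size_polyXn addSn /= leq_subLR.
have := ltn_modp P g; rewrite g0 addnC => lt_r.
by rewrite leq_add2r -ltnS prednK ?size_poly_gt0.
Qed.

Lemma lquot_coefE h g n (j : int) (l : nat) : g != 0 -> j + n%:Z = l%:Z ->
  lquot_coef h g j = (('X^n * h) %/ g)`_l.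
Proof.
move=> g0; case: j => j /= E.
  have {E} <- : (j + n)%N = l by apply/eqP; rewrite -eqz_nat -E.
  by rewrite -[n in 'X^n]add0n divp_shift // expr0 mul1r.
have -> : n = (j.+1 + l)%N.
  by apply/eqP; rewrite -eqz_nat PoszD -E NegzE addrA subrr add0r.
by rewrite -[l in RHS](add0n l) divp_shift.
Qed.

(* [lquot h g] is the quotient h/g in F((1/T)): multiplying by g gives h. *)
Lemma lquotP h g : g != 0 -> forall k : int,
  \sum_(i < size g) g`_i * lquot h g (k - i%:Z) =
  (if k is Posz n then h`_n else 0).
Proof.
move=> g0 k; pose n := (size g + absz k)%N.
have [l El gl] : exists2 l : nat, k + n%:Z = l%:Z & (size g <= l)%N.
  by exists (absz (k + n%:Z)); rewrite /n; lia.
transitivity ((('X^n * h) %/ g * g)`_l).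
  rewrite mulrC coefM.
  rewrite -(big_mkord xpredT (fun i => g`_i * lquot h g (k - i%:Z))).
  rewrite -(big_mkord xpredT (fun i => g`_i * (('X^n * h) %/ g)`_(l - i))).
  rewrite [RHS](big_cat_nat (leq0n (size g)) (leqW gl)) /=.
  rewrite [X in _ = _ + X]big_nat_cond [X in _ = _ + X]big1 ?addr0; last first.
    by move=> i /andP[/andP[gi _] _]; rewrite nth_default ?mul0r.
  apply: eq_big_nat => i /andP[_ ig]; congr (_ * _).
  apply: lquot_coefE => //; rewrite addrAC El -subzn //.
  exact: leq_trans (ltnW ig) gl.
have -> : ('X^n * h) %/ g * g = 'X^n * h - ('X^n * h) %% g.
  by rewrite [X in _ = X - _](divp_eq _ g) addrK.
rewrite coefB [X in _ - X]nth_default ?subr0; last first.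
  by apply: leq_trans gl; apply: ltnW; rewrite ltn_modp.
rewrite coefXnM.
move: (n) El => m {n}; case: k => k El.
  have <- : (k + m)%N = l by apply/eqP; rewrite -eqz_nat -El.
  by rewrite ltnNge leq_addl /= addnK.
by rewrite ifT //; move: El; rewrite NegzE; lia.
Qed.

End QuotientExpansion.

Definition e_inf (R : realType) (p : nat) (F : finFieldType)
  (charFp : p \in [pchar F]) (a : laurent F) : R[i] := e_q R charFp (a (-1)).

Notation ratfun R := {fraction {poly R[i]}}.

Section RationalFunctions.
Variable R : realType.
Implicit Types (H w : ratfun R) (P Q : {poly R[i]}).

Local Notation tofrac := (@FracField.tofrac {poly R[i]}).

Definition rconst (a : R[i]) : ratfun R := tofrac a%:P.
HB.instance Definition _ := GRing.RMorphism.copy rconst (tofrac \o polyC).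

Definition rvar : ratfun R := tofrac 'X.

(* H has no pole at u, and takes the value v there. *)
Definition rat_value H (u v : R[i]) : Prop :=
  exists P Q, [/\ H = tofrac P / tofrac Q, Q.[u] != 0 & v = P.[u] / Q.[u]].

(* H(w); by [rcompE] it is computed from any representation of H as a quotient
   of polynomials as soon as w is transcendental, i.e. not constant. *)
Definition rcomp H w : ratfun R :=
  (map_poly rconst (frac (generic_quotient.repr H)).1).[w]
    / (map_poly rconst (frac (generic_quotient.repr H)).2).[w].

Lemma rfrac_repr H : H = tofrac (frac (generic_quotient.repr H)).1
                          / tofrac (frac (generic_quotient.repr H)).2.
Proof.
set x := generic_quotient.repr H; have Ex : \pi%qT x = H by rewrite reprK.
apply: (canRL (mulfK _)); first by rewrite tofrac_eq0 denom_ratioP.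
rewrite -Ex; unlock FracField.tofrac; rewrite -[LHS]FracField.pi_mul.
apply/eqmodP; rewrite /= FracField.equivfE /FracField.mulf.
by rewrite !numden_Ratio ?mulf_neq0 ?oner_neq0 ?denom_ratioP // !mulr1 mulrC.
Qed.

Lemma rfrac_cross P Q P' Q' : Q != 0 -> Q' != 0 ->
  tofrac P / tofrac Q = tofrac P' / tofrac Q' -> P * Q' = P' * Q.
Proof.
move=> Q0 Q0' /eqP; rewrite eqr_div ?tofrac_eq0 //.
by rewrite -!tofracM tofrac_eq => /eqP.
Qed.

Lemma rcompE P Q w : Q != 0 ->
  (forall S, S != 0 -> (map_poly rconst S).[w] != 0) ->
  rcomp (tofrac P / tofrac Q) w =
    (map_poly rconst P).[w] / (map_poly rconst Q).[w].
Proof.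
move=> Q0 w_tr; rewrite /rcomp; set H := tofrac P / _.
have d0 := denom_ratioP (generic_quotient.repr H).
apply/eqP; rewrite eqr_div ?w_tr // -!hornerM -!rmorphM /=.
by rewrite (rfrac_cross d0 Q0 (esym (rfrac_repr H))).
Qed.

Lemma rvar_inv_transcendental (a : R[i]) S : a != 0 -> S != 0 ->
  (map_poly rconst S).[1 / (rconst a * rvar)] != 0.
Proof.
move=> a0 S0; pose v := a%:P * 'X; pose n := (size S).-1.
have v0 : tofrac v != 0 by rewrite tofrac_eq0 mulf_neq0 ?polyC_eq0 ?polyX_eq0.
have -> : rconst a * rvar = tofrac v by rewrite /rconst /rvar -tofracM.
have szS : size S = n.+1 by rewrite prednK // size_poly_gt0.
have : (map_poly rconst S).[1 / tofrac v] * tofrac v ^+ n =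
       tofrac (\sum_(i < n.+1) (S`_i)%:P * v ^+ (n - i)).
  rewrite horner_coef size_map_poly szS mulr_suml rmorph_sum.
  apply: eq_bigr => i _; rewrite coef_map /= [RHS]tofracM [in RHS]tofracXn -mulrA.
  congr (_ * _); rewrite div1r exprVn mulrC expfB_cond // (negbTE v0) /=.
  by rewrite add0n -ltnS.
move=> E; apply/eqP => S_eq0; move/eqP: E.
rewrite S_eq0 mul0r eq_sym tofrac_eq0 => /eqP/(congr1 (fun P => P.[0])).
rewrite horner_sum horner0 big_ord_recr /= subnn big1 => [|i _].
  rewrite add0r expr0 mulr1 hornerC => /eqP.
  by apply/negP; rewrite -[_`_n]/(lead_coef S) lead_coef_eq0.
have -> : (n - i = (n - i.+1).+1)%N by rewrite subnSK.
by rewrite exprS /v !hornerM hornerX !(mulr0, mul0r).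
Qed.

(* Unconditional summation over the polynomials f satisfying D. *)
Definition psums_to (F : finFieldType) (D : pred {poly F})
    (a : {poly F} -> R[i]) (u v : R[i]) : Prop :=
  (partial_sum (fun f : {f : {poly F} | D f} => a (val f) * u ^+ deg (val f))
     @ totally --> (v : R[i]^o))%classic.

Definition continues (F : finFieldType) (D : pred {poly F})
    (a : {poly F} -> R[i]) (H : ratfun R) : Prop :=
  forall u : R[i], `|u| < (#|F|%:R)^-1 ->
    exists2 v, psums_to D a u v & rat_value H u v.

Lemma continues_uniq (F : finFieldType) (D : pred {poly F})
    (a : {poly F} -> R[i]) (H H' : ratfun R) :
  continues D a H -> continues D a H' -> H = H'.
Proof.
move=> cH cH'; pose q : R[i] := #|F|%:R.
have q0 : 0 < q by rewrite ltr0n; apply/card_gt0P; exists 0.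
set n := (frac (generic_quotient.repr H)).1.
set d := (frac (generic_quotient.repr H)).2.
set n' := (frac (generic_quotient.repr H')).1.
set d' := (frac (generic_quotient.repr H')).2.
have HE : H = tofrac n / tofrac d := rfrac_repr H.
have HE' : H' = tofrac n' / tofrac d' := rfrac_repr H'.
have d0 : d != 0 := denom_ratioP _.
have d0' : d' != 0 := denom_ratioP _.
have val (K : ratfun R) N E (u v : R[i]) : K = tofrac N / tofrac E -> E != 0 ->
    rat_value K u v -> N.[u] = v * E.[u].
  move=> -> E0 [P [Q [/rfrac_cross EQ Qu ->]]].
  have Q0 : Q != 0 by apply: contraNneq Qu => ->; rewrite horner0.
  apply: (mulIf Qu); rewrite -hornerM EQ // hornerM.
  by rewrite mulrAC divfK.
suff nd0 : n * d' - n' * d = 0.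
  by rewrite HE HE'; apply/eqP; rewrite eqr_div ?tofrac_eq0 // -!tofracM
    tofrac_eq -subr_eq0 nd0.
apply/eqP/negPn/negP => nd0; set G := n * d' - n' * d in nd0.
pose s := [seq (q * k.+2%:R)^-1 | k <- iota 0 (size G)].
suff : (size s < size G)%N by rewrite size_map size_iota ltnn.
apply: max_poly_roots => //; last first.
  rewrite map_inj_uniq ?iota_uniq // => i j /invr_inj.
  move/(mulfI (lt0r_neq0 q0))/eqP.
  by rewrite eqr_nat !eqSS => /eqP.
apply/allP => _ /mapP[k _ ->]; set u : R[i] := _^-1.
have u_lt : `|u| < q^-1.
  have qk : 0 < q * k.+2%:R by rewrite mulr_gt0 // ltr0n.
  rewrite ger0_norm ?invr_ge0 ?ltW // ltf_pV2 //.
  by rewrite -[ltLHS]mulr1 ltr_pM2l // ltr1n.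
have [v Sv Hv] := cH _ u_lt; have [v' Sv' Hv'] := cH' _ u_lt.
have vv' : v = v'.
  have F_totally := @totally_filter {f : {poly F} | D f}.
  exact: (cvg_unique (@norm_hausdorff _ R[i]^o) Sv Sv').
rewrite rootE hornerD hornerN !hornerM (val _ _ _ _ _ HE d0 Hv).
by rewrite (val _ _ _ _ _ HE' d0' Hv') -vv' mulrAC subrr.
Qed.

(* The rational function that extends \sum_(f | D f) a(f) u^(deg f) from the
   disc |u| < 1/q; there is at most one by [continues_uniq]. *)
Definition continuation (F : finFieldType) (D : pred {poly F})
    (a : {poly F} -> R[i]) : ratfun R :=
  xget 0 [set H | continues D a H]%classic.

End RationalFunctions.

Arguments rvar {R}.

Section GeneratingSeries.
Variables (R : realType) (p : nat) (F : finFieldType).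
Hypothesis charFp : p \in [pchar F].

Definition Zgen (c g : {poly F}) : ratfun R :=
  continuation (fun f => (f \is monic) && (g %| f - c)) (fun=> 1).

Definition D1gen (c g : {poly F}) : ratfun R :=
  continuation (fun f => f \is monic)
    (fun f => e_inf R charFp (lquot (c * f) g)).

End GeneratingSeries.

(* Main.v *)
Require Import Defs.
From HB Require Import structures.
From mathcomp Require Import all_boot all_order all_algebra all_fingroup all_field.
From mathcomp Require Import finmap complex.
From mathcomp Require Import all_classical all_reals all_analysis.
From mathcomp.analysis.showcase Require Import summability.
From mathcomp Require Import ring lra zify.

(** Both sides are computed in closed form. Let n = deg g, r = c mod g, and, when
    r <> 0, k = n - deg r - 1. A class mod g contains q^(d-n) monic polynomials of
    degree d >= n and only r in degree < n, so
      Z(u; c, g) = [r monic] u^(deg r) + u^n / (1 - q u).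
    The coefficient of 1/T in c f / g is the coefficient of T^(n-1) in c f mod g.
    It vanishes for all f of degree < k, and for deg f = k it is
    lead_coef r * lead_coef f; by orthogonality the monic f of degree > k contribute
    nothing to D_1, so for r <> 0
      D_1(u; c/g) = sum_(d < k) (q u)^d + e_q(lead_coef r) (q u)^k,
    while D_1(u; c/g) = 1 / (1 - q u) for r = 0. After the substitution 1/(q u) the sum
    over lambda is evaluated by orthogonality again: lambda -> e_q(- lambda) detects
    lead_coef r = 1. *)

Set Implicit Arguments.
Unset Strict Implicit.
Unset Printing Implicit Defensive.

Import Order.TTheory GRing.Theory Num.Theory.
Import numFieldNormedType.Exports.
Local Open Scope ring_scope.

(** * The additive character of F *)

Section AdditiveCharacter.
Variables (R : realType) (p : nat) (F : finFieldType).
Hypothesis charFp : p \in [pchar F].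

Let p_prime : prime p.
Proof. exact: pcharf_prime charFp. Qed.

Lemma FqTrD (x y : F) : FqTr charFp (x + y) = FqTr charFp x + FqTr charFp y.
Proof.
(* [FqTr] is known only through its image in the field ([FqTrP]), so additivity is checked after the
   injective map from the prime field. *)
apply: (@fmorph_inj _ _ (in_alg (pPrimeCharType charFp))).
rewrite rmorphD /= !FqTrP.
exact: (raddfD (galTrace 1%AS {:pPrimeCharType charFp})).
Qed.

(** By independence of the Galois automorphisms, their sum with all coefficients 1, which is the
    trace, is not the zero map. *)
Lemma FqTr_neq0 : exists y : F, FqTr charFp y != 0.
Proof.
set L := pPrimeCharType charFp.
have [a _ tr0] : exists2 a, a \in {:L}%VS &
    \sum_(s in 'Gal({:L} / 1%AS)%g) (fun=> 1) s * s a != 0.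
  by apply: gal_independent_contra (group1 _) _; exact: oner_neq0.
exists (a : F); apply: contraNneq tr0 => tr0.
have : galTrace 1%AS {:L} a = 0 by rewrite -FqTrP tr0 scale0r.
rewrite /galTrace => tra; apply/eqP; rewrite -[RHS]tra.
by apply: eq_bigr => s _; rewrite mul1r.
Qed.

Lemma cos_sin_periodic (t : R) (n : nat) :
  (cos (t + 2 * pi * n%:R) = cos t) * (sin (t + 2 * pi * n%:R) = sin t).
Proof.
have -> : 2 * pi * n%:R = pi *+ 2 *+ n :> R by rewrite mulr_natr [2 * _]mulr_natl.
by rewrite (periodicn (@cosD2pi R)) (periodicn (@sinD2pi R)).
Qed.

Lemma e_qD (x y : F) :
  e_q R charFp (x + y) = e_q R charFp x * e_q R charFp y.
Proof.
rewrite /e_q FqTrD; set a := FqTr _ x; set b := FqTr _ y.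
have p0 : p%:R != 0 :> R by rewrite pnatr_eq0 -lt0n prime_gt0.
set A := 2 * pi * (a : nat)%:R / _; set B := 2 * pi * (b : nat)%:R / _.
set C := 2 * pi * _ / _.
(* The sum [a + b] in the prime field is reduced modulo p, so the angles [C] and [A + B] differ by
   [2 * pi] times the quotient [(a + b) %/ p]. *)
have EC : C + 2 * pi * ((a + b) %/ p)%N%:R = A + B.
  have -> : A + B = 2 * pi * (a + b)%N%:R / p%:R by rewrite natrD mulrDr mulrDl.
  have -> : C = 2 * pi * ((a + b) %% p)%N%:R / p%:R by rewrite /C /= [X in (_ %% X)%N]Fp_cast.
  rewrite [in RHS](divn_eq (a + b)%N p) natrD natrM.
  by field.
rewrite -(cos_sin_periodic C ((a + b) %/ p)) EC.
rewrite -[sin C](cos_sin_periodic C ((a + b) %/ p)) EC cosD sinD.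
by apply/eqP; rewrite eq_complex /= eqxx addrC eqxx.
Qed.

Lemma norm_e_q (x : F) : `|e_q R charFp x| = 1.
Proof. by rewrite /e_q normc_def cos2Dsin2 sqrtr1. Qed.

Lemma e_q_neq0 (x : F) : e_q R charFp x != 0.
Proof. by rewrite -normr_gt0 norm_e_q ltr01. Qed.

Lemma e_q0 : e_q R charFp 0 = 1.
Proof.
by apply: (mulfI (e_q_neq0 0)); rewrite -e_qD addr0 mulr1.
Qed.

Lemma e_q_nontrivial : exists y : F, e_q R charFp y != 1.
Proof.
have [y tr0] := FqTr_neq0; exists y.
rewrite /e_q; move: (FqTr _ y) tr0 => k k0.
have kp : (k < p)%N by rewrite -[X in (_ < X)%N]Fp_cast ?ltn_ord.
have {}k0 : (0 < k)%N by rewrite lt0n.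
have p0 : 0 < p%:R :> R by rewrite ltr0n prime_gt0.
rewrite eq_complex negb_and /=; apply/orP; left.
(* By the half angle t = pi k / p, which lies strictly between 0 and pi, the real part is 1 - 2
   sin(t)^2 < 1. *)
have -> : 2 * pi * k%:R / p%:R = (pi * (k%:R / p%:R)) *+ 2 :> R.
  by rewrite -[RHS]mulr_natl !mulrA.
rewrite cos_mulr2n cos2sin2.
have : 0 < sin (pi * (k%:R / p%:R) : R).
  apply: sin_gt0_pi; rewrite mulr_gt0 ?pi_gt0 ?divr_gt0 ?ltr0n ?(prime_gt0 p_prime) //=.
  by rewrite gtr_pMr ?pi_gt0 // ltr_pdivrMr // mul1r ltr_nat.
move/(exprn_gt0 2)=> s0; rewrite lt_eqF //; lra.
Qed.

End AdditiveCharacter.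

(** Translation by an [x] with [chi x != 1] permutes the terms and multiplies the sum by [chi x], so
    [chi x - 1] annihilates it. *)
Lemma sum_character (U : finZmodType) (K : idomainType) (chi : U -> K) :
  {morph chi : x y / x + y >-> x * y} -> (exists x, chi x != 1) ->
  \sum_x chi x = 0.
Proof.
move=> chiD [x chix]; apply/eqP; rewrite -(mulrI_eq0 _ (@mulfI _ (chi x - 1) _)).
  rewrite mulrBl mul1r mulr_sumr subr_eq0; apply/eqP.
  rewrite [RHS](reindex_inj (addrI x)) /=.
  by apply: eq_bigr => y _; rewrite chiD.
by rewrite subr_eq0.
Qed.
(** * Summation over monic polynomials *)

Lemma size_deg (K : nzRingType) (f : {poly K}) : f != 0 -> size f = (deg f).+1.
Proof. by move=> f0; rewrite /deg prednK // size_poly_gt0. Qed.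

Section MonicPolynomials.
Variable F : finFieldType.
Implicit Types f : {poly F}.

(** The vector holds the coefficients below the leading one, so the monic polynomials of degree d
    are indexed by a finite type with q^d elements. *)
Definition monic_rV d (v : 'rV[F]_d) : {poly F} := 'X^d + rVpoly v.

Lemma size_monic_rV d (v : 'rV[F]_d) : size (monic_rV v) = d.+1.
Proof. by rewrite size_polyDl size_polyXn // ltnS size_poly. Qed.

Lemma deg_monic_rV d (v : 'rV[F]_d) : deg (monic_rV v) = d.
Proof. by rewrite /deg size_monic_rV. Qed.

Lemma monic_rV_monic d (v : 'rV[F]_d) : monic_rV v \is monic.
Proof.
by rewrite monicE lead_coefDl ?lead_coefXn // size_polyXn ltnS size_poly.
Qed.

Lemma monic_rV_inj d : injective (@monic_rV d).
Proof. by move=> v w /addrI /(can_inj rVpolyK). Qed.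

Lemma monic_rV_deg f d : f \is monic -> deg f = d ->
  exists v : 'rV[F]_d, f = monic_rV v.
Proof.
move=> f_mon <-; have szf : size f = (deg f).+1.
  by rewrite prednK // size_poly_gt0 monic_neq0.
exists (poly_rV (f - 'X^(deg f))).
rewrite /monic_rV poly_rV_K ?subrKC //; apply/leq_sizeP => j.
rewrite leq_eqVlt coefB coefXn => /predU1P[<-|lt_j].
  by move/monicP: f_mon; rewrite lead_coefE eqxx => ->; rewrite subrr.
by rewrite nth_default ?szf // gtn_eqF ?subrr.
Qed.

Lemma sum_by_degree (V : nmodType) (G : {poly F} -> V) (s : seq {poly F}) M :
    uniq s -> {in s, forall f, (f \is monic) && (deg f < M)%N} ->
  \sum_(f <- s) G f =
  \sum_(d < M) \sum_(v : 'rV[F]_d | monic_rV v \in s) G (monic_rV v).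
Proof.
move=> s_uniq s_mon.
transitivity (\sum_(f <- s) \sum_(d < M | deg f == d) G f).
  rewrite [LHS]big_seq [RHS]big_seq; apply: eq_bigr => f /s_mon/andP[_ ltM].
  by rewrite (big_pred1 (Ordinal ltM)) // => d /=; rewrite eq_sym.
rewrite (exchange_big_dep predT) //=; apply: eq_bigr => d _.
rewrite -big_filter -[RHS]big_filter -(big_map (@monic_rV d) predT G).
apply: perm_big; apply: uniq_perm.
- exact: filter_uniq.
- rewrite map_inj_uniq ?filter_uniq ?index_enum_uniq //; exact: monic_rV_inj.
move=> f; rewrite mem_filter; apply/andP/mapP.
  move=> [/eqP fd sf]; have /andP[/monic_rV_deg/(_ fd)[v Ef] _] := s_mon f sf.
  exists v => //.
  by rewrite mem_filter mem_index_enum -Ef sf.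
by move=> [v]; rewrite mem_filter => /andP[sv _] ->; rewrite deg_monic_rV eqxx.
Qed.

End MonicPolynomials.

(** * Series graded by degree and their continuation *)

Lemma complex_pow_small (R : realType) (x eps : R[i]%C) :
  0 <= x < 1 -> 0 < eps -> exists N, forall n, (N <= n)%N -> x ^+ n < eps.
Proof.
move=> /andP[x0 x1] e0.
(* Comparability with 0 forces [x] and [eps] to be real, which reduces the claim to a real geometric
   sequence. *)
have Ex : x = (complex.Re x)%:C%C by rewrite RRe_real // ger0_real.
have Ee : eps = (complex.Re eps)%:C%C by rewrite RRe_real // gtr0_real.
move: x0 x1 e0; rewrite Ex Ee; move: (complex.Re x) (complex.Re eps) => y e.
rewrite -[0]/(0%:C%C) -[1]/(1%:C%C) lecR !ltcR => y0 y1 e0.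
have : (GRing.exp y @ \oo --> (0 : R))%classic.
  by apply: cvg_expr; rewrite ger0_norm.
move/cvgrPdist_lt => /(_ e e0) [N _ HN]; exists N => n Nn.
have := HN n Nn; rewrite sub0r normrN ger0_norm ?exprn_ge0 //.
by rewrite -rmorphXn ltcR.
Qed.

Section GradedSummation.
Variables (R : realType) (F : finFieldType).
Variables (D : pred {poly F}) (a : {poly F} -> R[i]%C).
Variables (A : nat -> R[i]%C) (K : nat) (C : R[i]%C).
Hypothesis D_monic : forall f, D f -> f \is monic.
Hypothesis norm_a : forall f, D f -> `|a f| <= 1.
Hypothesis AE : forall d, \sum_(v : 'rV[F]_d | D (monic_rV v)) a (monic_rV v) = A d.
Hypothesis A_geometric : forall d, (K <= d)%N -> A d = C * (#|F|%:R) ^+ d.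

Local Notation q := (#|F|%:R : R[i]%C).

(** From [K] on, each degree sum is a geometric term that can move from the closed tail to the
    finite sum. The cutoff can thus be taken as large as an estimate requires. *)
Lemma graded_tail (u : R[i]%C) n : (K <= n)%N -> 1 - q * u != 0 ->
  \sum_(d < K) A d * u ^+ d + C * (q * u) ^+ K / (1 - q * u) =
  \sum_(d < n) A d * u ^+ d + C * (q * u) ^+ n / (1 - q * u).
Proof.
move=> /subnKC <- qu1; elim: (n - K)%N => [|m IHm]; first by rewrite addn0.
rewrite addnS big_ord_recr /= IHm -addrA; congr (_ + _).
rewrite A_geometric ?leq_addr // exprS -[_ * u ^+ _]mulrA -exprMn.
by field.
Qed.

(* The at most q^d monic polynomials of degree d contribute at most (q |u|)^d, so any
   finite set containing all f of degree < n has a sum close to the sum over those f. *)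
Lemma psums_to_graded (u : R[i]%C) : `|u| < q^-1 ->
  psums_to D a u (\sum_(d < K) A d * u ^+ d + C * (q * u) ^+ K / (1 - q * u)).
Proof.
have q0 : 0 < q by rewrite ltr0n; apply/card_gt0P; exists 0.
move=> u_small; set x := q * `|u|.
have x0 : 0 <= x by rewrite mulr_ge0 ?normr_ge0 // ltW.
have x1 : x < 1 by rewrite /x mulrC -ltr_pdivlMr // div1r.
have normqu : `|q * u| = x by rewrite normrM ger0_norm // ltW.
have le_qu : 1 - x <= `|1 - q * u|.
  by rewrite -normqu -[X in X - _](@normr1 R[i]%C); exact: lerB_dist.
have x'0 : 0 < 1 - x by rewrite subr_gt0.
have qu0 : 1 - q * u != 0 by rewrite -normr_gt0 (lt_le_trans x'0).
rewrite /psums_to; set S := \sum_(d < K) _ + _.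
have totF := @totally_filter {f : {poly F} | D f}.
apply/(@pseudometric_normed_Zmodule.cvgrPdist_lt _ R[i]%C^o) => eps eps0.
have C1 : 0 < `|C| + 1 by rewrite ltr_wpDl ?normr_ge0 ?ltr01.
(* The final error is below [(|C| + 1) * x ^+ n / (1 - x)] up to equality: [|C|] comes from the
   closed tail, 1 from the polynomials of degree at least n. *)
have [||N xN] := @complex_pow_small R x (eps * (1 - x) / (`|C| + 1)).
- by rewrite x0.
- by rewrite divr_gt0 // mulr_gt0.
pose n := maxn K N.
have Kn : (K <= n)%N by exact: leq_maxl.
have {xN} : x ^+ n < eps * (1 - x) / (`|C| + 1) by apply: xN; exact: leq_maxr.
rewrite ltr_pdivlMr // => xN.
(* This lists all members of [D] of degree below n; [insub] drops the monic polynomials outside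
   [D]. *)
pose l : seq {f : {poly F} | D f} :=
  flatten [seq pmap insub [seq monic_rV v | v <- enum 'rV[F]_d] | d <- iota 0 n].
pose A0 := [fset f in l]%fset.
have A0P (f : {f : {poly F} | D f}) : (deg (val f) < n)%N -> f \in A0.
  move=> fn; rewrite inE; apply/flattenP; exists (pmap insub
    [seq monic_rV v | v <- enum 'rV[F]_(deg (val f))]).
    by apply/mapP; exists (deg (val f)); rewrite // mem_iota.
  rewrite mem_pmap_sub; have [v ->] := monic_rV_deg (D_monic (valP f)) erefl.
  by rewrite deg_monic_rV; apply: map_f; rewrite mem_enum.
exists A0 => // B A0B; rewrite /partial_sum.
rewrite -(big_seq_fsetE _ B predT (fun f => a (val f) * u ^+ deg (val f))) /=.
rewrite -(big_map val predT (fun f => a f * u ^+ deg f)).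
set s := [seq val f | f <- B].
pose M := (n + \max_(f <- s) (deg f).+1)%N.
have s_uniq : uniq s by rewrite map_inj_uniq ?fset_uniq //; exact: val_inj.
have sD f : f \in s -> D f by case/mapP => z _ ->; exact: valP.
have s_mon : {in s, forall f, (f \is monic) && (deg f < M)%N}.
  move=> f sf; rewrite D_monic ?sD //= ltn_addl //.
  by rewrite (big_rem f) //= leq_max leqnn.
rewrite (sum_by_degree _ s_uniq s_mon) -(big_mkord xpredT (fun d =>
  \sum_(v : 'rV[F]_d | monic_rV v \in s) a (monic_rV v) * u ^+ deg (monic_rV v))).
rewrite (big_cat_nat (leq0n n)) ?leq_addr //= big_mkord.
rewrite /S (graded_tail Kn qu0).
have -> : \sum_(d < n) \sum_(v : 'rV[F]_d | monic_rV v \in s)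
    a (monic_rV v) * u ^+ deg (monic_rV v) = \sum_(d < n) A d * u ^+ d.
  apply: eq_bigr => d _; rewrite -AE mulr_suml; apply: eq_big => v.
    apply/idP/idP => [/sD //|Dv].
    apply/mapP; exists (Sub _ Dv); rewrite ?SubK //.
    by apply: (fsubsetP A0B); apply: A0P; rewrite SubK deg_monic_rV.
  by rewrite deg_monic_rV.
set X := \sum_(d < n) _; rewrite opprD addrA [X in X - _]addrAC subrr add0r.
apply: le_lt_trans (ler_normB _ _) _.
apply: (@le_lt_trans _ _ ((`|C| + 1) * (x ^+ n / (1 - x)))); last first.
  by rewrite mulrC -mulrA mulrCA mulrC ltr_pdivrMr // mulrC -mulrA.
rewrite mulrDl mul1r; apply: lerD.
  rewrite !normrM normrX normqu normfV -mulrA.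
  rewrite ler_wpM2l // ler_wpM2l ?exprn_ge0 //.
  by rewrite lef_pV2 ?posrE ?normr_gt0.
apply: (@le_trans _ _ (\sum_(n <= d < M) x ^+ d)).
  apply: le_trans (ler_norm_sum _ _ _) _; apply: ler_sum => d _.
  apply: le_trans (ler_norm_sum _ _ _) _.
  apply: (@le_trans _ _ (\sum_(v : 'rV[F]_d) `|u| ^+ d)).
    rewrite [leLHS]big_mkcond; apply: ler_sum => v _ /=; case: ifP => [sv|_].
      by rewrite deg_monic_rV normrM normrX ler_piMl ?exprn_ge0 ?norm_a ?sD.
    by rewrite exprn_ge0.
  by rewrite sumr_const card_mx mul1n -mulr_natl natrX -exprMn.
rewrite ler_pdivlMr //.
have -> : (\sum_(n <= d < M) x ^+ d) * (1 - x) = x ^+ n - x ^+ M.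
  rewrite mulr_suml -[RHS]opprB -(telescope_sumr (fun d => x ^+ d)) ?leq_addr // -sumrN.
  by apply: eq_bigr => d _; rewrite opprB mulrBr mulr1 -exprSr.
by rewrite lerBlDr lerDl exprn_ge0.
Qed.

Local Notation tofrac := (@FracField.tofrac {poly R[i]%C}).

(** The closed form of the sum is a rational function whose only possible pole has |u| = 1/q,
    outside the open disc; uniqueness of the continuation does the rest. *)
Lemma continuation_graded : continuation D a =
  tofrac ((\poly_(d < K) A d) * (1 - q%:P * 'X) + C%:P * (q%:P * 'X) ^+ K)
    / tofrac (1 - q%:P * 'X).
Proof.
set H := _ / _.
have cH : continues D a H.
  move=> u u_small; eexists; first exact: psums_to_graded u_small.
  have q0 : 0 < q by rewrite ltr0n; apply/card_gt0P; exists 0.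
  have qu0 : 1 - q * u != 0.
    rewrite subr_eq0; apply: contraTneq u_small => /(congr1 Num.norm) E.
    rewrite normr1 normrM (ger0_norm (ltW q0)) in E.
    by rewrite -[q^-1]mul1r ltr_pdivlMr // mulrC -E ltxx.
  do 2 eexists; split; first by reflexivity.
    by rewrite !hornerE.
  rewrite !hornerE horner_poly.
  by field.
by apply: xget_unique => // H' cH'; exact: continues_uniq cH' cH.
Qed.

End GradedSummation.

(** * Coefficients of D_1 and Z *)

Section ResidueCoefficient.
Variable F : fieldType.
Implicit Types f g h : {poly F}.

Lemma lquot_residue h g : g \is monic -> lquot h g (-1) = (h %% g)`_(size g).-2.
Proof.
move=> g_mon; have g0 := monic_neq0 g_mon.
have ltr := ltn_modp h g; rewrite g0 in ltr.
rewrite /= [X in _ * X](divp_eq h g); set r := h %% g in ltr *.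
rewrite mulrDr mulrA divp_addl_mul // coefD expr1 coefXM add0r.
set a := r`_ _.
(* As [g] is monic, subtracting [a%:P * g] cancels the coefficient of ['X * r] in degree deg g; the
   rest is smaller than [g], so [a] is the whole quotient. *)
have -> : 'X * r = a%:P * g + ('X * r - a%:P * g) by rewrite addrC subrK.
rewrite divp_addl_mul // coefD coefC eqxx divp_small ?coef0 ?addr0 //.
have gs : (0 < size g)%N by rewrite size_poly_gt0.
rewrite -(prednK gs) ltnS; apply/leq_sizeP => j lej.
rewrite coefB coefXM coefCM.
case: j lej => [|j] /=; last first.
  rewrite leq_eqVlt => /predU1P[Ej|lt_j].
    have -> : g`_j.+1 = 1 by rewrite -Ej -lead_coefE (monicP g_mon).
    by rewrite mulr1 /a Ej subrr.
  rewrite [g`__]nth_default ?mulr0 ?subr0; last by rewrite -(prednK gs).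
  by rewrite nth_default // -ltnS (leq_trans ltr) // -(prednK gs).
(* Here [g] is constant: the index [(size g).-2] is truncated to 0, which is harmless because [r] is
   0. *)
rewrite leqn0 => /eqP s1; rewrite /a nth_default ?mul0r ?subr0 //.
by rewrite s1 -ltnS (leq_trans ltr) // -(prednK gs) s1.
Qed.

Lemma lquot_residueD h1 h2 g : g \is monic ->
  lquot (h1 + h2) g (-1) = lquot h1 g (-1) + lquot h2 g (-1).
Proof. by move=> g_mon; rewrite !lquot_residue // modpD coefD. Qed.

Lemma lquot_residue_modl c f g : g \is monic ->
  lquot (c * f) g (-1) = lquot ((c %% g) * f) g (-1).
Proof. by move=> g_mon; rewrite !lquot_residue // mulrC -modp_mul mulrC. Qed.

Lemma lquot_residue_small (r f g : {poly F}) : g \is monic -> r != 0 ->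
  (size (r * f)%R < size g)%N -> lquot (r * f) g (-1) =
    if (deg r + deg f == (size g).-2)%N then lead_coef r * lead_coef f else 0.
Proof.
move=> g_mon r0 lt_rf; rewrite lquot_residue // modp_small //.
have [->|f0] := eqVneq f 0.
  by rewrite mulr0 coef0 lead_coef0 mulr0 if_same.
have szrf : size (r * f) = (deg r + deg f).+1.
  by rewrite size_mul // (size_deg r0) (size_deg f0) addSn addnS.
case: eqP => [<-|ne]; first by rewrite -lead_coefM lead_coefE szrf.
rewrite nth_default // szrf; move: lt_rf ne; rewrite szrf.
by move: (deg r + deg f)%N (size g) => x y; lia.
Qed.

End ResidueCoefficient.

Section D1Coefficients.
Variables (R : realType) (p : nat) (F : finFieldType).
Hypothesis charFp : p \in [pchar F].
Variables (c g : {poly F}).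
Hypothesis g_monic : g \is monic.

Local Notation q := (#|F|%:R : R[i]%C).
Local Notation chi f := (e_inf R charFp (lquot (c * f) g)).
Local Notation k := (deg g - deg (c %% g) - 1)%N.

Lemma e_inf_mulD (f1 f2 : {poly F}) : chi (f1 + f2) = chi f1 * chi f2.
Proof. by rewrite /e_inf mulrDr lquot_residueD // e_qD. Qed.

(** All the residues vanish, so every term is 1. The factor 1 in the result is the constant [C] of
    [A_geometric]. *)
Lemma sum_e_inf_monic0 d : c %% g = 0 ->
  \sum_(v : 'rV[F]_d | monic_rV v \is monic) chi (monic_rV v) = 1 * q ^+ d.
Proof.
move=> r0; under eq_bigl do rewrite monic_rV_monic.
rewrite (eq_bigr (fun=> 1)) => [|v _].
  by rewrite sumr_const card_mx !mul1n natrX mul1r.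
by rewrite /e_inf lquot_residue_modl // r0 mul0r lquot_residue // mod0p coef0 e_q0.
Qed.

(** The factor [chi 'X^d] comes out and leaves a character sum over the additive group of
    polynomials of degree below d; that character is trivial exactly when d is at most k. *)
Lemma sum_e_inf_monic d : c %% g != 0 ->
  \sum_(v : 'rV[F]_d | monic_rV v \is monic) chi (monic_rV v) =
  if (d < k)%N then q ^+ d
  else if d == k then e_q R charFp (lead_coef (c %% g)) * q ^+ k else 0.
Proof.
set r := c %% g => r0.
have szg : size g = (deg g).+1 by rewrite size_deg ?monic_neq0.
have lt_rg : (deg r < deg g)%N.
  by have := ltn_modp c g; rewrite monic_neq0 // -/r (size_deg r0) szg.
have chi_small (f : {poly F}) : (size f <= k.+1)%N ->
    chi f = if deg f == k then e_q R charFp (lead_coef r * lead_coef f) else 1.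
  move=> szf; rewrite /e_inf lquot_residue_modl // -/r lquot_residue_small //.
    have -> : (deg r + deg f == (size g).-2)%N = (deg f == k).
      rewrite szg /=; move: (deg r) (deg f) (deg g) lt_rg => x y z lt_xz.
      by apply/eqP/eqP; lia.
    by rewrite (fun_if (e_q R charFp)) e_q0.
  apply: leq_ltn_trans (size_polyMleq _ _) _.
  move: lt_rg szf; rewrite szg (size_deg r0).
  by move: (deg r) (size f) (deg g) => x y z; lia.
have chi_low (f : {poly F}) : (size f <= k)%N -> chi f = 1.
  move=> szf; have [->|f0] := eqVneq f 0.
    by rewrite /e_inf mulr0 lquot_residue // mod0p coef0 e_q0.
  rewrite chi_small; last exact: leqW.
  by move: szf; rewrite (size_deg f0) => /ltn_eqF ->.
pose S : R[i]%C := \sum_(v : 'rV[F]_d) chi (rVpoly v).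
have sum_low : (d <= k)%N -> S = q ^+ d.
  move=> dk; rewrite /S (eq_bigr (fun=> 1)) => [|v _].
    by rewrite sumr_const card_mx mul1n natrX.
  by rewrite chi_low // (leq_trans (size_poly _ _)).
transitivity (chi 'X^d * S).
  rewrite /S mulr_sumr; apply: eq_big => v; first exact: monic_rV_monic.
  by move=> _; rewrite -e_inf_mulD.
case: ltnP => [dk|].
  by rewrite sum_low ?(ltnW dk) // chi_low ?size_polyXn // mul1r.
rewrite leq_eqVlt => /predU1P[Ek|kd].
  rewrite -Ek eqxx sum_low -?Ek // chi_small ?size_polyXn ?Ek //.
  by rewrite /deg size_polyXn eqxx lead_coefXn mulr1.
(* The character f -> chi f is nontrivial on polynomials of degree < d, as it already
   takes the value e_q y at f = (y / lead_coef r) T^k. *)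
rewrite gtn_eqF // /S [X in _ * X](@sum_character _ _ (fun v => chi (rVpoly v))).
- by rewrite mulr0.
- by move=> v w /=; rewrite linearD e_inf_mulD.
have [y y1] := e_q_nontrivial R charFp.
have lr0 : lead_coef r != 0 by rewrite lead_coef_eq0.
have y0 : y != 0 by apply: contraNneq y1 => ->; rewrite e_q0.
have z0 : (lead_coef r)^-1 * y != 0 by rewrite mulf_neq0 ?invr_eq0.
pose f := ((lead_coef r)^-1 * y) *: 'X^k : {poly F}.
have szf : size f = k.+1 by rewrite size_scale ?size_polyXn.
exists (poly_rV f); rewrite poly_rV_K ?szf // chi_small ?szf //.
by rewrite /deg szf eqxx lead_coefZ lead_coefXn mulr1 mulVKf.
Qed.

End D1Coefficients.

Section CongruenceCounts.
Variables (F : finFieldType) (c g : {poly F}).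
Hypothesis g_monic : g \is monic.

Lemma dvdp_subE (f : {poly F}) : (g %| f - c) = (f %% g == c %% g).
Proof. by rewrite /dvdp modpD modpN subr_eq0. Qed.

Lemma count_congruent_low d : (d < deg g)%N ->
  (\sum_(v : 'rV[F]_d | (monic_rV v \is monic) && (g %| monic_rV v - c)%R) 1)%N
  = (c %% g \is monic) && (deg (c %% g) == d) :> nat.
Proof.
move=> dg; have szg : size g = (deg g).+1 by rewrite size_deg ?monic_neq0.
have predE (v : 'rV[F]_d) : (monic_rV v \is monic) && (g %| monic_rV v - c)
    = (monic_rV v == c %% g).
  rewrite monic_rV_monic dvdp_subE modp_small //.
  by rewrite size_monic_rV szg ltnS.
rewrite (eq_bigl _ _ predE); case: andP => [[r_mon /eqP rd]|not_r].
  have [v0 Ev0] := monic_rV_deg r_mon rd.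
  by rewrite (big_pred1 v0) // => v; rewrite Ev0 /= (inj_eq (@monic_rV_inj _ _)).
apply: big1 => v /eqP Ev; case: not_r.
by rewrite -Ev monic_rV_monic deg_monic_rV eqxx.
Qed.

Lemma count_congruent d : (deg g <= d)%N ->
  (\sum_(v : 'rV[F]_d | (monic_rV v \is monic) && (g %| monic_rV v - c)%R) 1)%N
  = (#|F| ^ (d - deg g))%N.
Proof.
move=> gd; have g0 := monic_neq0 g_monic; have szg := size_deg g0.
have lt_rg : (size (c %% g)%R < size g)%N by rewrite ltn_modp.
rewrite sum1_card -[(d - deg g)%N]mul1n -card_mx.
(* Monic polynomials of degree d in the class are counted by their quotients by [g], which run
   through all monic polynomials of degree d - deg g. *)
pose h (w : 'rV[F]_(d - deg g)) := monic_rV w * g + c %% g.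
have sz_wg (w : 'rV[F]_(d - deg g)) : size (monic_rV w * g) = d.+1.
  rewrite size_monicM ?monic_rV_monic // size_monic_rV szg.
  by rewrite addSn addnS /= subnK.
have lt_r (w : 'rV[F]_(d - deg g)) : (size (c %% g)%R < size (monic_rV w * g)%R)%N.
  by rewrite sz_wg (leq_trans lt_rg) // szg ltnS.
have h_monic w : h w \is monic.
  by rewrite monicE lead_coefDl // -monicE monicMr ?monic_rV_monic.
have h_deg w : deg (h w) = d by rewrite /deg size_polyDl // sz_wg.
pose k w : 'rV[F]_d := poly_rV (h w - 'X^d).
have kE w : monic_rV (k w) = h w.
  have [v Ev] := monic_rV_deg (h_monic w) (h_deg w).
  by rewrite /k Ev /monic_rV addrAC subrr add0r rVpolyK.
have k_inj : injective k.
  move=> w w' /(congr1 (@monic_rV F d)); rewrite !kE => /addIr/(mulIf g0).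
  exact: monic_rV_inj.
rewrite -(card_codom k_inj); apply: eq_card => v.
rewrite [LHS]unfold_in monic_rV_monic dvdp_subE.
apply/eqP/codomP => [Ev|[w ->]]; last first.
  by rewrite kE /h modp_addl_mul_small.
have Ef : monic_rV v = monic_rV v %/ g * g + c %% g by rewrite -Ev -divp_eq.
set f := monic_rV v %/ g in Ef.
have sz_fg : size f = (d - deg g).+1.
  by rewrite /f size_divp // size_monic_rV szg /= subSn.
have f_monic : f \is monic.
  rewrite -(monicMr _ g_monic) monicE -[f * g](addrK (c %% g)) -Ef.
  rewrite lead_coefDl -?monicE ?monic_rV_monic // size_polyN size_monic_rV.
  by rewrite (leq_trans lt_rg) // szg ltnS.
have [|w Ew] := @monic_rV_deg _ f (d - deg g) f_monic; first by rewrite /deg sz_fg.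
by exists w; apply: (@monic_rV_inj F d); rewrite kE /h -Ew.
Qed.

End CongruenceCounts.

Section RationalFunctionValues.
Variable R : realType.
Implicit Types (P : {poly R[i]%C}) (w : ratfun R).

Local Notation tofrac := (@FracField.tofrac {poly R[i]%C}).

(** Viewing a polynomial as its own value at the variable lets [horner_graded] serve both for Z at u
    and for D_1 at 1/(qu). *)
Lemma tofrac_horner P : tofrac P = (map_poly (@rconst R) P).[rvar].
Proof.
rewrite horner_coef size_map_poly -[in LHS](coefK P) poly_def rmorph_sum.
apply: eq_bigr => i _; rewrite coef_map /= -mul_polyC tofracM tofracXn //.
Qed.

Lemma horner_graded (A : nat -> R[i]%C) K (C b : R[i]%C) w :
  let Q := 1 - b%:P * 'X in
  let P := (\poly_(d < K) A d) * Q + C%:P * (b%:P * 'X) ^+ K in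
  (map_poly (@rconst R) Q).[w] != 0 ->
  (map_poly (@rconst R) P).[w] / (map_poly (@rconst R) Q).[w] =
  \sum_(d < K) rconst (A d) * w ^+ d +
    rconst C * (rconst b * w) ^+ K / (1 - rconst b * w).
Proof.
pose ev S := (map_poly (@rconst R) S).[w].
have evD S T : ev (S + T) = ev S + ev T by rewrite /ev rmorphD hornerD.
have evM S T : ev (S * T) = ev S * ev T by rewrite /ev rmorphM hornerM.
have evC x : ev x%:P = rconst x by rewrite /ev map_polyC hornerC.
have evX m S : ev (S ^+ m) = ev S ^+ m by rewrite /ev rmorphXn horner_exp.
have evbX : ev (b%:P * 'X) = rconst b * w.
  by rewrite evM evC /ev map_polyX hornerX.
move=> Q P; have evQ : ev Q = 1 - rconst b * w.
  by rewrite /Q evD -evbX /ev rmorph1 hornerC rmorphN hornerN.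
rewrite -/(ev Q) -/(ev P) evQ => Q0.
rewrite [ev P]evD (evM _ Q) evQ (evM C%:P) evC evX evbX.
have -> : ev (\poly_(d < K) A d) = \sum_(d < K) rconst (A d) * w ^+ d.
  rewrite poly_def /ev rmorph_sum horner_sum; apply: eq_bigr => d _.
  by rewrite /= -mul_polyC -/(ev _) evM evC evX /ev map_polyX hornerX.
by rewrite mulrDl mulfK.
Qed.

End RationalFunctionValues.

(** * Closed forms as rational functions *)

Section FieldIdentities.
Variables (K : fieldType) (q u M : K).
Hypotheses (q0 : q != 0) (u0 : u != 0) (u1 : 1 - u != 0) (qu1 : 1 - q * u != 0).

(* Here M stands for u^(deg g) and, below, m for u^(deg r), y for u^(-k) and S for
   the sum of the u^(-d), d < k. *)
Lemma assemble_zero : M / (1 - q * u) =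
  M / u * ((-1 / q - (q - 1) * (1 / (q * (1 - q * u)))) * (1 - u^-1)^-1).
Proof.
have -> : 1 - u^-1 = - (1 - u) / u by field.
by field; rewrite u0 q0 oppr_eq0 u1 qu1.
Qed.

Lemma assemble_nonzero (b : bool) (S y m : K) (B := 1 / (q * (1 - q * u))) :
    S * (1 - u) = u * (y - 1) -> M * y = u * m ->
  (if b then m else 0) + M / (1 - q * u) =
  M / u * (S / q * -1 + y / q * ((if b then q else 0) - 1) - (B * S * (q - 1) + B * y * (0 - 1))).
Proof.
(* The two hypotheses eliminate [m] and [S], leaving a rational identity in q, u, M and y. *)
move=> ES Em; have -> : m = M * y / u by rewrite Em mulrC mulKf.
have -> : S = u * (y - 1) / (1 - u) by rewrite -ES mulfK.
rewrite /B; case: b; field; by rewrite ?u0 ?q0 ?u1 ?qu1.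
Qed.

End FieldIdentities.

Lemma sum_inv_powers (K : fieldType) (u : K) k : u != 0 ->
  (\sum_(d < k) u^-1 ^+ d) * (1 - u) = u * (u^-1 ^+ k - 1).
Proof.
by move=> u0; rewrite subrX1 mulrA [u * _]mulrBr mulfV // mulr1 mulrC.
Qed.

Lemma exprDVK (K : fieldType) (u : K) m k : u != 0 ->
  u ^+ (m.+1 + k) * u^-1 ^+ k = u * u ^+ m.
Proof. by move=> u0; rewrite exprD exprVn mulfK ?expf_neq0 // exprS. Qed.

(** Expanding the product isolates four sums over the index, each of which becomes a character sum
    or a count of the nonzero scalars. *)
Lemma sum_bilinear (K : comPzRingType) (I : finType) (P : pred I)
    (E1 E2 : I -> K) (a B S y : K) :
  \sum_(i | P i) (E1 i * a - B) * (S + E2 i * y) =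
  S * a * (\sum_(i | P i) E1 i) + y * a * (\sum_(i | P i) E2 i * E1 i)
    - (B * S * (\sum_(i | P i) 1) + B * y * (\sum_(i | P i) E2 i)).
Proof.
rewrite !mulr_sumr -!big_split -sumrB /=; apply: eq_bigr => i _.
by ring.
Qed.

Section ClosedForms.
Variables (R : realType) (p : nat) (F : finFieldType).
Hypothesis charFp : p \in [pchar F].
Variables (c g : {poly F}).
Hypothesis g_monic : g \is monic.

Local Notation q := (#|F|%:R : ratfun R).
Local Notation u := (@rvar R).
Local Notation qC := (#|F|%:R : R[i]%C).

Lemma qC_neq0 : qC != 0.
Proof. by rewrite pnatr_eq0 -lt0n; apply/card_gt0P; exists 0. Qed.

Lemma rconst_q : rconst qC = q.
Proof. exact: rmorph_nat. Qed.

Lemma q_neq0 : q != 0.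
Proof. by rewrite -rconst_q fmorph_eq0 qC_neq0. Qed.

Lemma rvar_neq0 : u != 0.
Proof. by rewrite tofrac_eq0 polyX_eq0. Qed.

Lemma sub1aX_neq0 (a : R[i]%C) : 1 - a%:P * 'X != 0.
Proof.
apply/eqP => /(congr1 (fun P => P.[0])).
by rewrite hornerD hornerN hornerM hornerX mulr0 subr0 horner0 hornerC => /eqP; rewrite oner_eq0.
Qed.

Lemma sub1au_neq0 (a : R[i]%C) : 1 - rconst a * u != 0.
Proof.
rewrite -[1](rmorph1 (@FracField.tofrac {poly R[i]%C})) -tofracM -tofracB.
by rewrite tofrac_eq0 sub1aX_neq0.
Qed.

Lemma Zgen_closed : Zgen R c g =
  (if c %% g \is monic then u ^+ deg (c %% g) else 0) +
  u ^+ deg g / (1 - q * u).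
Proof.
pose D (f : {poly F}) := (f \is monic) && (g %| f - c).
pose A d : R[i]%C := \sum_(v : 'rV[F]_d | D (monic_rV v)) 1.
have AE d : A d = (\sum_(v : 'rV[F]_d | D (monic_rV v)) 1)%N%:R.
  by rewrite natr_sum.
have A_high d : (deg g <= d)%N -> A d = qC ^- deg g * qC ^+ d.
  move=> gd; rewrite AE count_congruent // natrX.
  by rewrite -{2}(subnK gd) exprD mulrCA mulVf ?mulr1 ?expf_neq0 ?qC_neq0.
have D_monic f : D f -> f \is monic by case/andP.
have norm1 f : D f -> `|1 : R[i]%C| <= 1 by rewrite normr1.
rewrite /Zgen (continuation_graded (A := A) D_monic norm1 (fun=> erefl) A_high).
rewrite !tofrac_horner horner_graded; last first.
  by rewrite -tofrac_horner tofrac_eq0 sub1aX_neq0.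
have -> : rconst (qC ^- deg g) * (rconst qC * u) ^+ deg g = u ^+ deg g.
  by rewrite fmorphV rmorphXn /= rconst_q exprMn mulKf ?expf_neq0 ?q_neq0.
rewrite rconst_q; congr (_ + _).
under eq_bigr => d _ do rewrite AE count_congruent_low //.
case: ifP => [r_mon|_] /=; last by rewrite big1 // => d _; rewrite rmorph0 mul0r.
have lt_rg : (deg (c %% g) < deg g)%N.
  have := ltn_modp c g; rewrite monic_neq0 // (size_deg (monic_neq0 g_monic)).
  by rewrite (size_deg (monic_neq0 r_mon)).
rewrite (bigD1 (Ordinal lt_rg)) //= eqxx rmorph1 mul1r big1 ?addr0 // => d ne.
by move: ne; rewrite -val_eqE /= eq_sym => /negbTE->; rewrite rmorph0 mul0r.
Qed.

Lemma invqu_transcendental (S : {poly R[i]%C}) : S != 0 ->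
  (map_poly (@rconst R) S).[1 / (q * u)] != 0.
Proof.
by rewrite -rconst_q; apply: rvar_inv_transcendental; exact: qC_neq0.
Qed.

Lemma norm_e_inf (a : laurent F) : `|e_inf R charFp a| <= 1.
Proof. by rewrite norm_e_q. Qed.

Lemma q_invqu : q * (1 / (q * u)) = u^-1.
Proof. by rewrite div1r invfM mulVKf ?q_neq0. Qed.

Lemma rcomp_D1gen0 : c %% g = 0 ->
  rcomp (D1gen R charFp c g) (1 / (q * u)) = (1 - u^-1)^-1.
Proof.
move=> r0; rewrite /D1gen (continuation_graded (fun _ => id) (K := 0)
  (fun f _ => norm_e_inf _) (fun d => sum_e_inf_monic0 R charFp g_monic d r0) (fun _ _ => erefl)).
rewrite rcompE ?sub1aX_neq0 //; last exact: invqu_transcendental.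
rewrite horner_graded; last by rewrite invqu_transcendental ?sub1aX_neq0.
by rewrite big_ord0 add0r expr0 mulr1 rmorph1 rconst_q q_invqu mul1r.
Qed.

Lemma rcomp_D1gen (k := (deg g - deg (c %% g) - 1)%N) : c %% g != 0 ->
  rcomp (D1gen R charFp c g) (1 / (q * u)) =
  \sum_(d < k) u^-1 ^+ d +
    rconst (e_q R charFp (lead_coef (c %% g))) * u^-1 ^+ k.
Proof.
move=> r0; pose A d : R[i]%C := if (d < k)%N then qC ^+ d
  else if d == k then e_q R charFp (lead_coef (c %% g)) * qC ^+ k else 0.
(* The cutoff is k + 1, since degree k still contributes; beyond it the degree sums vanish, hence
   the constant 0. *)
have A_high d : (k < d)%N -> A d = 0 * qC ^+ d.
  by move=> kd; rewrite /A ltnNge ltnW //= gtn_eqF // mul0r.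
rewrite /D1gen (continuation_graded (fun _ => id)
  (fun f _ => norm_e_inf _) (fun d => sum_e_inf_monic R charFp g_monic d r0) A_high).
rewrite rcompE ?sub1aX_neq0 //; last exact: invqu_transcendental.
rewrite horner_graded; last by rewrite invqu_transcendental ?sub1aX_neq0.
rewrite rmorph0 !mul0r addr0 big_ord_recr /= /A ltnn eqxx.
rewrite rmorphM rmorphXn /= rconst_q -mulrA -exprMn q_invqu; congr (_ + _).
apply: eq_bigr => d _; rewrite ltn_ord.
by rewrite rmorphXn /= rconst_q -exprMn q_invqu.
Qed.

(** Orthogonality applies to the sum over all scalars; the final -1 removes the term at 0. *)
Lemma sum_e_q_scaled (b : F) :
  \sum_(lam : F | lam != 0) rconst (e_q R charFp (lam * b)) =
  (if b == 0 then q else 0) - 1.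
Proof.
have -> : (if b == 0 then q else 0) =
    rconst (\sum_(lam : F) e_q R charFp (lam * b)).
  case: eqP => [->|/eqP b0].
    rewrite (eq_bigr (fun=> 1)) => [|lam _]; last by rewrite mulr0 e_q0.
    by rewrite sumr_const -rconst_q.
  rewrite [X in rconst X](@sum_character _ _ (fun lam => e_q R charFp (lam * b))).
  - by rewrite rmorph0.
  - by move=> x y /=; rewrite mulrDl e_qD.
  have [y y1] := e_q_nontrivial R charFp.
  by exists (y / b); rewrite divfK.
rewrite [X in _ = rconst X - _](bigD1 0) //= mul0r e_q0 rmorphD rmorph1 rmorph_sum.
by rewrite addrAC subrr add0r.
Qed.

End ClosedForms.

(** * Evaluation of the sum over lambda *)

Unset Implicit Arguments.

Theorem proposition3p2 (R : realType) (p : nat) (F : finFieldType)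
    (charFp : p \in [pchar F]) (c g : {poly F}) (g_monic : g \is monic) :
  let q : ratfun R := #|F|%:R in
  let u : ratfun R := rvar in
  Zgen R c g =
    u ^ ((deg g)%:Z - 1) *
    \sum_(lam : F | lam != 0)
      (rconst (e_q R charFp (- lam)) / q - 1 / (q * (1 - q * u))) *
      rcomp (D1gen R charFp (lam *: c) g) (1 / (q * u)).
Proof.
move=> q u; have q0 : q != 0 := q_neq0 R F; have u0 : u != 0 := rvar_neq0 R.
have qu1 : 1 - q * u != 0 by rewrite /q -rconst_q sub1au_neq0.
have u1 : 1 - u != 0 by rewrite -[u]mul1r -(rmorph1 (@rconst R)) sub1au_neq0.
(* The exponent is an integer, equal to -1 when g = 1; since u is nonzero, the power splits as
   [u ^+ deg g] times the inverse of u. *)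
rewrite Zgen_closed // expfzDr // -exprnP exprN1.
pose E x := rconst (e_q R charFp x).
pose B := 1 / (q * (1 - q * u)).
have sumE b : \sum_(lam : F | lam != 0) E (lam * b) = (if b == 0 then q else 0) - 1.
  exact: sum_e_q_scaled.
have sumN : \sum_(lam : F | lam != 0) E (- lam) = -1.
  under eq_bigr do rewrite -mulrN1.
  by rewrite sumE oppr_eq0 oner_eq0 sub0r.
have sum1 : \sum_(lam : F | lam != 0) (1 : ratfun R) = q - 1.
  have := sumE 0; rewrite eqxx => <-.
  by apply: eq_bigr => lam _; rewrite mulr0 /E e_q0 rmorph1.
have [r0|r0] := eqVneq (c %% g) 0.
  rewrite r0 monicE lead_coef0 eq_sym oner_eq0 add0r.
  rewrite (eq_bigr (fun lam => (E (- lam) / q - 1 * B) * (1 - u^-1)^-1)); last first.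
    by move=> lam _; rewrite rcomp_D1gen0 ?modpZl ?r0 ?scaler0 // [1 * B]mul1r.
  rewrite -mulr_suml sumrB -!mulr_suml sumN sum1.
  exact: (assemble_zero (u ^+ deg g) q0 u0 u1 qu1).
set r := c %% g in r0 *; set k := (deg g - deg r - 1)%N.
pose y := u^-1 ^+ k; pose S := \sum_(d < k) u^-1 ^+ d.
have lr0 : lead_coef r != 0 by rewrite lead_coef_eq0.
(* A nonzero scalar keeps the degree of [r], hence k and [S]; it only scales the leading coefficient
   inside the character. *)
rewrite (eq_bigr (fun lam => (E (- lam) / q - B) * (S + E (lam * lead_coef r) * y)));
    last first.
  move=> lam lam0.
  have degr : deg (lam *: r) = deg r by rewrite /deg size_scale.
  by rewrite rcomp_D1gen ?modpZl ?scaler_eq0 ?negb_or ?lam0 // -/r degr lead_coefZ.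
rewrite sum_bilinear sumN sum1 sumE (negbTE lr0).
(* The product of the two character values is [E (lam * (lead_coef r - 1))], so its sum detects
   whether [r] is monic. *)
rewrite [X in y / q * X](eq_bigr (fun lam => E (lam * (lead_coef r - 1)))); last first.
  by move=> lam _; rewrite mulrBr mulr1 /E e_qD rmorphM.
rewrite sumE subr_eq0.
have lt_rg : (deg r < deg g)%N.
  have := ltn_modp c g; rewrite monic_neq0 // (size_deg (monic_neq0 g_monic)).
  by rewrite -/r (size_deg r0).
(* By the choice of k, deg g = deg r + 1 + k, where [lt_rg] keeps the natural subtraction exact. *)
have Em : u ^+ deg g * y = u * u ^+ deg r.
  rewrite -(exprDVK (deg r) k u0); congr (u ^+ _ * _).
  by rewrite /k -subnDA addn1 subnKC.
rewrite monicE.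
exact: (assemble_nonzero q0 u0 u1 qu1 (lead_coef r == 1) (sum_inv_powers k u0) Em).
Qed.
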